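(* Let $R$ be a commutative ring, $M$ an $R$-module and $T$ a non-empty closed subset of $\mathrm{Spec}(M)$, and suppose that $\bar M$ is a cyclic module. Then: (a) If $P_1,\dots,P_n$ are distinct and $\{P_1,\dots,P_n\}\subseteq \mathrm{Min}(T)$, then there exists a clique of size $n$ in $G(\tau_T)$. (b) $\omega(G(\tau_T))\geq |\mathrm{Min}(T)|$, and if $|\mathrm{Min}(T)|\geq 3$, then $\mathrm{gr}(G(\tau_T))=3$. (c) If $\sqrt{(\bar 0)}=(\bar 0)$ in $\bar M$, then $\chi(G(\tau_{\mathrm{Spec}(M)}))=\omega(G(\tau_{\mathrm{Spec}(M)}))=|\mathrm{Min}(T)|$.
   Context: Rings are commutative with non-zero identity and modules are unital. $N<M$ means $N$ is a proper submodule of $M$. $(N:M)=\{r\in R: rM\subseteq N\}$. A prime submodule of $M$ is a submodule $P\neq M$ such that $re\in P$ ($r\in R$, $e\in M$) implies $r\in(P:M)$ or $e\in P$. $\mathrm{Spec}(M)$ is the set of prime submodules of $M$, and $V(N)=\{P\in\mathrm{Spec}(M): (P:M)\supseteq (N:M)\}$ for a submodule $N$ of $M$. The Zariski topology on $\mathrm{Spec}(M)$ has the sets $V(N)$, $N$ a submodule of $M$, as its closed sets. For a non-empty $T\subseteq\mathrm{Spec}(M)$, $G(\tau_T)$ is the undirected graph with vertex set $\{N<M : \text{there exists } K<M \text{ with } V(N)\cup V(K)=T \text{ and } V(N),V(K)\neq T\}$, where distinct vertices $N,L$ are adjacent if and only if $V(N)\cup V(L)=T$; $G(\tau_{\mathrm{Spec}(M)})$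 is this graph for $T$ replaced by $\mathrm{Spec}(M)$. $Q:=(\bigcap_{P\in T}P:M)M$ and $\bar M:=M/Q$. $\mathrm{Min}(T)$ is the set of minimal members of $T$ (under inclusion). The prime radical $\sqrt N$ of a submodule $N$ of a module is the intersection of all prime submodules of that module containing $N$ (the whole module if there are none). $\omega(G)$ is the supremum of the sizes of cliques of $G$, $\chi(G)$ is the chromatic number, and $\mathrm{gr}(G)$ is the girth (length of a shortest cycle). Infinite values are written $\infty$.
   Formalization: The graph is assumed to have a vertex in (a) for n=1, in the bound ω ≥ |Min(T)| of (b), and in (c) (fails for R=M a field); in (c) T is taken to be Spec(M) (fails for R=M=Z/6, T={2Z/6}). *)

(* Defs.v *)
From HB Require Import structures.
From mathcomp Require Import all_boot all_order all_algebra.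
From mathcomp Require Import finmap all_classical all_reals.
From mathcomp Require Import ereal counting_measure Rstruct.

Set Implicit Arguments.
Unset Strict Implicit.
Unset Printing Implicit Defensive.

Import Order.TTheory GRing.Theory Num.Theory.

Local Open Scope classical_set_scope.
Local Open Scope ring_scope.
Local Open Scope quotient_scope.

(* Sizes, clique numbers, chromatic numbers and girths are extended reals, so
   that every infinite value is the single symbol +oo. *)
Notation real := Rdefinitions.R.

Section SimpleGraphs.

(* The vertices of a graph form a subset of an ambient type; the adjacency
   relation is only meaningful between vertices. *)
Record sgraph (V : choiceType) := SGraph {
  vertices : set V;
  adj : rel V;
  adj_sym : symmetric adj;
  adj_irr : irreflexive adj }.

Variables (V : choiceType) (G : sgraph V).

Definition is_clique (A : {fset V}) : Prop :=
  [set` A] `<=` vertices G /\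
  (forall x y, x \in A -> y \in A -> x != y -> adj G x y).

Definition clique_number : \bar real :=
  ereal_sup [set (#|` A|)%:R%:E | A in [set A | is_clique A]].

Definition colorable (n : nat) : Prop :=
  exists c : V -> nat,
    (forall x, vertices G x -> (c x < n)%N) /\
    (forall x y, vertices G x -> vertices G y -> adj G x y -> c x != c y).

Definition chromatic_number : \bar real :=
  ereal_inf [set n%:R%:E | n in [set n | colorable n]].

Definition is_cycle (s : seq V) : Prop :=
  [/\ (2 < size s)%N, uniq s, [set` s] `<=` vertices G & cycle (adj G) s].

Definition girth : \bar real :=
  ereal_inf [set (size s)%:R%:E | s in [set s | is_cycle s]].

End SimpleGraphs.

(* A submodule of M is a [submodClosed M]. Its closure axioms are propositions,
   so two submodules with the same elements are equal. *)
HB.instance Definition _ (R : comNzRingType) (M : lmodType R) :=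
  gen_eqMixin (submodClosed M).
HB.instance Definition _ (R : comNzRingType) (M : lmodType R) :=
  gen_choiceMixin (submodClosed M).

Section Submodules.

Variables (R : comNzRingType) (M : lmodType R).

Definition smeet_pred (F : set (submodClosed M)) : {pred M} :=
  fun x => `[< forall N : submodClosed M, F N -> x \in N >].

Lemma smeet_closed F : submod_closed (smeet_pred F).
Proof.
split; first by apply/asboolP => N _; exact: rpred0.
move=> a x y /asboolP xF /asboolP yF; apply/asboolP => N FN.
by rewrite rpredD ?rpredZ ?xF ?yF.
Qed.

HB.instance Definition _ F :=
  GRing.isSubmodClosed.Build R M (smeet_pred F) (smeet_closed F).

(* The intersection of a family of submodules; it is M for the empty family. *)
Definition smeet (F : set (submodClosed M)) : submodClosed M := smeet_pred F.

Lemma pred0_closed : submod_closed (pred1 (0 : M)).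
Proof.
split; first exact: eqxx.
by move=> a x y /eqP -> /eqP ->; rewrite inE scaler0 addr0.
Qed.

Definition szero_pred : {pred M} := pred1 0.

HB.instance Definition _ :=
  GRing.isSubmodClosed.Build R M szero_pred pred0_closed.

Definition szero : submodClosed M := szero_pred.

(* IM, the submodule generated by the products r *: e with r in I. *)
Definition ideal_smul (I : set R) : submodClosed M :=
  smeet [set N : submodClosed M | forall r e, I r -> r *: e \in N].

Definition is_proper (N : submodClosed M) : Prop := exists x, x \notin N.

(* (N : M) *)
Definition colon (N : submodClosed M) : set R :=
  [set r | forall x, r *: x \in N].

Definition prime_submodule (P : submodClosed M) : Prop :=
  is_proper P /\
  (forall (r : R) (e : M), r *: e \in P -> colon P r \/ e \in P).

(* This is M when no prime submodule contains N, by the convention of [smeet]. *)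
Definition prime_radical (N : submodClosed M) : submodClosed M :=
  smeet [set P | prime_submodule P /\ {subset N <= P}].

Definition cyclic_module : Prop := exists x : M, forall y, exists r, y = r *: x.

End Submodules.

Arguments szero {R} M.
Arguments cyclic_module {R} M.

Section QuotientModule.

Variables (R : comNzRingType) (M : lmodType R) (N : submodClosed M).

(* [submodClosed] does not inherit from [zmodClosed], which the library's
   quotient requires. *)
Definition submod_pred : {pred M} := fun x => x \in N.

Lemma submod_pred_closed : zmod_closed submod_pred.
Proof.
split; first exact: rpred0.
move=> x y xN yN; rewrite -[- y]scaleN1r; apply: rpredD => //.
exact: rpredZ.
Qed.

HB.instance Definition _ :=
  GRing.isZmodClosed.Build M submod_pred submod_pred_closed.

(* M / N: the library makes it a zmodType; we add the R-module structure. *)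
Definition quotmod : Type := {ideal_quot submod_pred}.

HB.instance Definition _ := GRing.Zmodule.on quotmod.

Definition quotmod_pi (x : M) : quotmod := \pi_({ideal_quot submod_pred}) x.
Definition quotmod_scale (a : R) (u : quotmod) : quotmod :=
  quotmod_pi (a *: repr (u : {ideal_quot submod_pred})).

Lemma quotmod_scale_pi a x :
  quotmod_scale a (quotmod_pi x) = quotmod_pi (a *: x).
Proof.
apply/eqP; rewrite /quotmod_pi -Quotient.idealrBE -scalerBr; apply: rpredZ.
by rewrite -[_ \in N]/(_ \in submod_pred) Quotient.idealrBE reprK.
Qed.

Lemma quotmod_piD : {morph quotmod_pi : x y / x + y}.
Proof. by move=> x y; exact: (Quotient.pi_add submod_pred). Qed.

Lemma quotmod_piP (u : quotmod) : exists x, u = quotmod_pi x.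
Proof. by exists (repr (u : {ideal_quot submod_pred})); rewrite /quotmod_pi reprK. Qed.

Lemma quotmod_scaleA a b u :
  quotmod_scale a (quotmod_scale b u) = quotmod_scale (a * b) u.
Proof.
by have [x ->] := quotmod_piP u; rewrite !quotmod_scale_pi scalerA.
Qed.

Lemma quotmod_scale1 : left_id 1 quotmod_scale.
Proof.
by move=> u; have [x ->] := quotmod_piP u; rewrite quotmod_scale_pi scale1r.
Qed.

Lemma quotmod_scaleDr : right_distributive quotmod_scale +%R.
Proof.
move=> a u v; have [x ->] := quotmod_piP u; have [y ->] := quotmod_piP v.
by rewrite -quotmod_piD !quotmod_scale_pi -quotmod_piD scalerDr.
Qed.

Lemma quotmod_scaleDl u : {morph quotmod_scale^~ u : a b / a + b}.
Proof.
move=> a b; have [x ->] := quotmod_piP u.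
by rewrite !quotmod_scale_pi -quotmod_piD scalerDl.
Qed.

HB.instance Definition _ := GRing.Zmodule_isLmodule.Build R quotmod
  quotmod_scaleA quotmod_scale1 quotmod_scaleDr quotmod_scaleDl.

End QuotientModule.

Section ZariskiTopologyGraph.

Variables (R : comNzRingType) (M : lmodType R).

Definition Spec : set (submodClosed M) := [set P | prime_submodule P].

Definition Var (N : submodClosed M) : set (submodClosed M) :=
  [set P | Spec P /\ colon N `<=` colon P].

(* The sets Var N are, by definition, all the closed sets of the topology. *)
Definition zariski_closed (T : set (submodClosed M)) : Prop :=
  exists N, T = Var N.

Definition minimals (T : set (submodClosed M)) : set (submodClosed M) :=
  [set P | T P /\ (forall P', T P' -> {subset P' <= P} -> P' = P)].

(* Q = ((\bigcap_(P in T) P) : M) M *)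
Definition Qsub (T : set (submodClosed M)) : submodClosed M :=
  ideal_smul M (colon (smeet T)).

Definition Mbar (T : set (submodClosed M)) : lmodType R := quotmod (Qsub T).

Variable T : set (submodClosed M).

Definition zgraph_vertices : set (submodClosed M) :=
  [set N | is_proper N /\
     exists K, [/\ is_proper K, Var N `|` Var K = T, Var N <> T & Var K <> T]].

Definition zgraph_adj : rel (submodClosed M) :=
  fun N L => `[< N <> L /\ Var N `|` Var L = T >].

Lemma zgraph_adj_sym : symmetric zgraph_adj.
Proof.
by move=> N L; apply/asboolP/asboolP => -[NL NLT]; split;
  rewrite 1?setUC // => /esym.
Qed.

Lemma zgraph_adj_irr : irreflexive zgraph_adj.
Proof. by move=> N; apply/asboolP => -[]. Qed.

Definition zgraph : sgraph (submodClosed M) :=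
  SGraph zgraph_vertices zgraph_adj_sym zgraph_adj_irr.

End ZariskiTopologyGraph.

Arguments Spec {R} M.

(* Main.v *)
(* Put J = (\bigcap_(P in T) P : M). Since M/Q is generated by one element,
   P |-> (P : M) is an order isomorphism from T onto the prime ideals
   containing J. Hence an element x of (P : M), for P minimal in T, is killed
   modulo J by some y outside (P : M). Given distinct minimal P_1, ..., P_n,
   this yields, for i != j, elements a_ij outside (P_i : M) and b_ij outside
   (P_j : M) with a_ij b_ij in J; then x_i = \prod_(j != i) a_ij b_ji is
   outside (P_i : M) and x_i x_j is in J for i != j, so that the submodules
   (x_i R + J) M form a clique as soon as n > 1. Conversely, every member of T
   contains a minimal one, so for each vertex N some minimal member of T lies
   outside V(N); coloring N by such a member is a proper coloring. *)
From HB Require Import structures.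
Require Import Defs.
From mathcomp Require Import all_boot all_order all_algebra.
From mathcomp Require Import finmap all_classical all_reals.
From mathcomp Require Import ereal counting_measure Rstruct.

Local Open Scope classical_set_scope.
Local Open Scope ring_scope.

Import Order.TTheory GRing.Theory Num.Theory.

Set Implicit Arguments.
Unset Strict Implicit.
Unset Printing Implicit Defensive.

(** Excluding 1 is enough, since there is no [i] when n = 0. It gives each vertex of the clique a
    neighbor. *)
Lemma ord_other n (i : 'I_n) : n != 1%N -> exists j, j != i.
Proof.
case: n i => [[]|[|n]]// i _.
have [->|i0] := eqVneq i ord0; first by exists ord_max.
by exists ord0; rewrite eq_sym.
Qed.

(** * Cliques, colorings and triangles in a graph *)

Section GraphBounds.

Variables (V : choiceType) (G : sgraph V).

Lemma clique_colorable (A : {fset V}) k :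
  is_clique G A -> colorable G k -> (#|` A| <= k)%N.
Proof.
move=> [AV Aadj] [c [ck cadj]].
rewrite -(size_map c) -(size_iota 0 k); apply: uniq_leq_size.
  rewrite map_inj_in_uniq// => x y xA yA cxy; apply/eqP; apply: contraPT cxy.
  move=> xy; apply/eqP/cadj; [exact: AV|exact: AV|exact: Aadj].
by move=> _ /mapP[x xA ->]; rewrite mem_iota add0n ck//; exact: AV.
Qed.

Lemma clique_le_chromatic : (clique_number G <= chromatic_number G)%E.
Proof.
apply: ge_ereal_sup => _ [A Acl <-]; apply: le_ereal_inf_tmp => _ [k Gk <-].
by rewrite lee_fin ler_nat; exact: clique_colorable.
Qed.

Lemma clique_number_ge (A : {fset V}) :
  is_clique G A -> ((#|` A|)%:R%:E <= clique_number G)%E.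
Proof. by move=> Acl; apply: ereal_sup_ubound; exists A. Qed.

(** A cycle has at least three vertices by definition, so a triangle attains the lower bound. *)
Lemma girth_triangle (A : {fset V}) : is_clique G A -> #|` A| = 3%N ->
  girth G = 3%:R%:E.
Proof.
move=> [AV Aadj] A3; apply/eqP; rewrite eq_le; apply/andP; split; last first.
  by apply: le_ereal_inf_tmp => _ [s [s3 _ _ _] <-]; rewrite lee_fin ler_nat.
apply: ereal_inf_lbound; exists (enum_fset A); last by rewrite /= A3.
split=> //; [by rewrite A3|].
have Au := fset_uniq A; have memA x : x \in enum_fset A -> x \in A by [].
case: (enum_fset A) A3 Au memA => [|x [|y [|z []]]]//= _.
rewrite !inE negb_or => /and3P[/andP[xy xz] yz _] memA.
by rewrite !Aadj ?memA ?inE ?eqxx ?orbT// eq_sym.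
Qed.

End GraphBounds.

(** * Ideals as sets, and primes avoiding a multiplicative set *)

Section PrimeIdeals.

Variable R : comNzRingType.
Implicit Types (I J S q : set R) (x y a : R).

Record ideal_set I : Prop := IdealSet {
  ideal0 : I 0;
  idealP : forall a x y, I x -> I y -> I (a * x + y) }.

Record prime_ideal_set q : Prop := PrimeIdealSet {
  prime_ideal_ideal : ideal_set q;
  prime_ideal1 : ~ q 1;
  prime_idealM : forall x y, q (x * y) -> q x \/ q y }.

Lemma idealMl I a x : ideal_set I -> I x -> I (a * x).
Proof. by move=> [I0 IP] Ix; rewrite -[a * x]addr0; apply: IP. Qed.

Lemma idealMr I a x : ideal_set I -> I x -> I (x * a).
Proof. by rewrite mulrC; exact: idealMl. Qed.

Lemma idealD I x y : ideal_set I -> I x -> I y -> I (x + y).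
Proof. by move=> [_ IP] Ix Iy; rewrite -[x]mul1r; apply: IP. Qed.

Lemma prime_ideal_prod q (I : finType) (P : pred I) (F : I -> R) :
  prime_ideal_set q -> (forall i, P i -> ~ q (F i)) ->
  ~ q (\prod_(i | P i) F i).
Proof.
by move=> [_ q1 qM] nF; elim/big_ind: _ => // x y nx ny /qM[].
Qed.

(** Krull's argument: an ideal maximal among those containing J and disjoint from S is prime. *)
Lemma prime_ideal_avoiding J S : ideal_set J -> S 1 ->
  (forall x y, S x -> S y -> S (x * y)) -> (forall x, J x -> ~ S x) ->
  exists q, [/\ prime_ideal_set q, J `<=` q & forall x, q x -> ~ S x].
Proof.
move=> idJ S1 SM JS; have [J0 JP] := idJ.
(* Unlike the ideals containing J, the class C contains the empty set, hence
   the union of the empty chain. *)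
pose C := [set X : set R | (forall a x y, X x -> X y \/ J y -> X (a * x + y)) /\
                           forall x, X x -> ~ S x].
have CJ : C J by split => // a x y Jx []; exact: JP.
have [F FC Ftot|A [[AP AS] Amax]] := @Zorn_bigcup R C.
  split=> [a x y [X FX Xx] [[Y FY Yy]|Jy]|x [X FX]]; last exact: (FC _ FX).2.
    have [XY|YX] := Ftot _ _ FX FY.
      by exists Y => //; apply: (FC _ FY).1; [exact: XY|left].
    by exists X => //; apply: (FC _ FX).1 => //; left; exact: YX.
  by exists X => //; apply: (FC _ FX).1 => //; right.
(* An empty A would be strictly contained in J, which belongs to C. *)
have [x0 Ax0] : A !=set0.
  apply: contrapT => /nonemptyPn A0; apply: (Amax J) => //.
  by rewrite A0; split=> [x //|/(_ _ J0)].
have A0 : A 0 by rewrite -[0](addNr x0) -mulN1r; apply: AP => //; left.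
have JA : J `<=` A.
  by move=> y Jy; rewrite -[y]add0r -(mul0r 0); apply: AP => //; right.
have idA : ideal_set A by split=> // a x y Ax Ay; apply: AP => //; left.
(* By maximality of A, the larger ideal A + Rx meets S. *)
have meetS x : ~ A x -> exists a r, A a /\ S (a + r * x).
  move=> nAx; apply: contrapT => nS.
  apply: (Amax [set z | exists2 a, A a & exists r, z = a + r * x]).
    split=> [z Az|sub]; first by exists z => //; exists 0; rewrite mul0r addr0.
    by apply/nAx/sub; exists 0 => //; exists 1; rewrite mul1r add0r.
  split=> [a _ y [b Ab [r ->]] Cy|_ [a Aa [r ->]] Sa]; last first.
    by apply: nS; exists a, r.
  have {Cy}[c Ac [s ->]] : exists2 c, A c & exists s, y = c + s * x.
    by case: Cy => // /JA Ay; exists y => //; exists 0; rewrite mul0r addr0.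
  exists (a * b + c); first by case: idA => _; apply.
  by exists (a * r + s); rewrite mulrDr mulrDl mulrA addrACA.
exists A; split=> //; split=> //; first by move=> /AS.
(* The product (a + rx)(b + sy) is in S, yet it is in A because xy is. *)
move=> x y Axy; apply: contrapT => /not_orP[/meetS[a [r [Aa Sx]]]].
move=> /meetS[b [s [Ab Sy]]]; apply: AS (SM _ _ Sx Sy).
rewrite mulrDl [r * x * _]mulrDr (mulrACA r x).
apply: idealD => //; first exact: idealMr.
by apply: idealD => //; exact: idealMl.
Qed.

End PrimeIdeals.

(** * Colon ideals, minimal members of a closed set, and the coloring *)

Section SubmoduleSpectrum.

Variables (R : comNzRingType) (M : lmodType R).
Implicit Types (N P : submodClosed M).

Lemma submodB N x y : x \in N -> y \in N -> x - y \in N.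
Proof. by have [_] := submod_pred_closed N; apply. Qed.

Lemma colon_ideal N : ideal_set (colon N).
Proof.
split=> [|a r s rN sN] x; first by rewrite scale0r rpred0.
rewrite scalerDl -scalerA; apply: rpredD; last exact: sN.
by apply: rpredZ; exact: rN.
Qed.

Lemma colonS N P : {subset N <= P} -> colon N `<=` colon P.
Proof. by move=> NP r rN x; exact/NP/rN. Qed.

Lemma colon_proper N : is_proper N -> ~ colon N 1.
Proof. by move=> [x /negP xN] /(_ x); rewrite scale1r. Qed.

Lemma colon_prime P : prime_submodule P -> prime_ideal_set (colon P).
Proof.
move=> [/colon_proper nP Pprime]; split=> //; first exact: colon_ideal.
move=> r s rsP; have [?|nr] := pselect (colon P r); [by left|right=> x].
by case: (Pprime r (s *: x)) => //; rewrite scalerA; exact: rsP.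
Qed.

Lemma mem_smeet (F : set (submodClosed M)) x :
  (x \in smeet F) <-> forall N, F N -> x \in N.
Proof. by split=> [/asboolP|?]; last exact/asboolP. Qed.

Lemma colon_ideal_smul (I : set R) : I `<=` colon (ideal_smul M I).
Proof. by move=> r Ir x; apply/mem_smeet => N; apply. Qed.

Lemma ideal_smul_sub (I : set R) N :
  I `<=` colon N -> {subset ideal_smul M I <= N}.
Proof. by move=> IN x /mem_smeet; apply=> r e Ir; exact: IN. Qed.

Lemma smeet_sub (F : set (submodClosed M)) N :
  F N -> {subset smeet F <= N}.
Proof. by move=> FN x /mem_smeet; apply. Qed.

Lemma colon_smeet (F : set (submodClosed M)) r :
  (forall N, F N -> colon N r) -> colon (smeet F) r.
Proof. by move=> Fr x; apply/mem_smeet => N FN; exact: Fr. Qed.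

Lemma cyclic_quotmod N : cyclic_module (quotmod N) ->
  exists m : M, forall y, exists r, y - r *: m \in N.
Proof.
move=> [u gen]; have [m um] := quotmod_piP u; exists m => y.
have [r] := gen (quotmod_pi N y); rewrite um => ym; exists r.
rewrite -[_ \in N]/(_ \in submod_pred N) Quotient.idealrBE; apply/eqP.
exact: etrans ym (quotmod_scale_pi _ _ _).
Qed.

(** If e is outside some P1 in the chain, then r lies in the colon of P1 and of each smaller member,
    hence also of each larger one. *)
Lemma smeet_chain_prime (C : set (submodClosed M)) :
  C !=set0 -> C `<=` Spec M ->
  (forall N P, C N -> C P -> {subset N <= P} \/ {subset P <= N}) ->
  prime_submodule (smeet C).
Proof.
move=> [P0 CP0] CSpec Ctot; split.
  have [[x xP0] _] := CSpec _ CP0; exists x.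
  by apply: contraNN xP0; exact: smeet_sub.
move=> r e re; have [?|] := pselect (e \in smeet C); first by right.
move=> /(contra_not (proj2 (mem_smeet _ _)))/existsNP[P1 /not_implyP[CP1 eP1]].
left; have reP P : C P -> colon P r \/ e \in P.
  by move=> CP; apply: (CSpec _ CP).2; exact: smeet_sub re.
apply: colon_smeet => P CP; have [PP1|P1P] := Ctot _ _ CP CP1.
  by have [//|/PP1] := reP _ CP.
by apply: colonS P1P _ _; have [] := reP _ CP1.
Qed.

Lemma submod_ext N P : {subset N <= P} -> {subset P <= N} -> N = P.
Proof.
case: N P => [f [[f1] [f2]]] [g [[g1] [g2]]] fg gf.
have efg : f = g.
  by apply/funext => x; apply/idP/idP; [exact: (fg x)|exact: (gf x)].
by subst g; rewrite (Prop_irrelevance f1 g1) (Prop_irrelevance f2 g2).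
Qed.

(** Zorn's lemma for reverse inclusion: a chain is bounded by its intersection, which is again
    prime. *)
Lemma minimals_below N P : Var N P ->
  exists2 P', minimals (Var N) P' & {subset P' <= P}.
Proof.
move=> NP; pose below := {P' | Var N P' /\ {subset P' <= P}}.
pose le (A B : below) := `[< {subset sval B <= sval A} >].
have P0 : below := exist _ P (conj NP (fun _ => id)).
have [//|||[P' [NP' P'P]] P'max] := @ZL_preorder below P0 le.
- by move=> A; apply/asboolP.
- by move=> A B C /asboolP AB /asboolP BC; apply/asboolP => x /BC /AB.
(* The intersection of the empty chain would be M, so P itself serves as its bound. *)
- move=> C Ctot; have [->|/set0P[P1 CP1]] := eqVneq C set0; first by exists P0.
  pose F := [set sval A | A in C].
  have FP A : C A -> {subset smeet F <= sval A}.
    by move=> CA; apply: smeet_sub; exists A.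
  have NF : Var N (smeet F).
    split; last first.
      by move=> r Nr; apply: colon_smeet => _ [A _ <-]; exact: (svalP A).1.2.
    apply: smeet_chain_prime; first by exists (sval P1), P1.
      by move=> _ [A _ <-]; exact: (svalP A).1.1.
    move=> _ _ [A CA <-] [B CB <-].
    by have [/asboolP|/asboolP] := Ctot _ _ CA CB; [right|left].
  have FsubP : {subset smeet F <= P} by move=> x /(FP _ CP1) /(svalP P1).2.
  exists (exist _ (smeet F) (conj NF FsubP)) => A CA.
  by apply/asboolP; exact: FP.
exists P' => //; split=> // P'' NP'' P''P'.
have P''P : {subset P'' <= P} by move=> x /P''P' /P'P.
apply: submod_ext => //.
have := P'max (exist _ P'' (conj NP'' P''P)).
by move=> /(_ (asboolT P''P')) /asboolP.
Qed.

(** The color of N is the index of the first minimal member outside [Var N]. Adjacent vertices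
    cannot share it, since their two closed sets cover T. *)
Lemma minimals_colorable N0 : let T := Var N0 in
  finite_set (minimals T) ->
  colorable (zgraph T) #|` fset_set (minimals T)|.
Proof.
move=> T finT; set B := fset_set _.
pose out N : pred (submodClosed M) := fun P => `[< ~ Var N P >].
(* [Var N] is closed upwards in T, so it would be all of T if it contained every minimal member. *)
have has_out N : vertices (zgraph T) N -> has (out N) B.
  move=> [_ [K [_ NKT NT _]]]; apply: contrapT => /negP/hasPn noB; apply: NT.
  apply/seteqP; split=> P; first by rewrite -NKT; left.
  move=> TP; have [P' P'min P'P] := minimals_below TP.
  have P'B : P' \in B by rewrite in_fset_set// inE.
  have /asboolPn/contrapT[_ NP'] := noB _ P'B.
  by split; [exact: TP.1|exact: subset_trans NP' (colonS P'P)].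
exists (fun N => find (out N) B); split=> [N /has_out|N K NV KV].
  by rewrite has_find.
move=> /asboolP[_ NKT]; apply/eqP => cNK.
have := nth_find N (has_out _ NV); have := nth_find N (has_out _ KV).
rewrite -cNK; set P := nth _ _ _ => /asboolP KP /asboolP NP.
have : P \in B by rewrite mem_nth// -has_find has_out.
by rewrite in_fset_set// inE => -[]; rewrite -NKT => -[].
Qed.

Lemma chromatic_le_counting N :
  (chromatic_number (zgraph (Var N)) <= counting (minimals (Var N)))%E.
Proof.
rewrite /counting; have [finT|infT] := pselect (finite_set (minimals (Var N))).
  rewrite asboolT//; apply: ereal_inf_lbound.
  by exists #|` fset_set (minimals (Var N))|; first exact: minimals_colorable.
by rewrite asboolF// leey.
Qed.

End SubmoduleSpectrum.

(** * The spectrum over a cyclic quotient, and the cliques it yields *)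

Section CyclicSpectrum.

Variables (R : comNzRingType) (M : lmodType R) (N0 : submodClosed M).

Let T := Var N0.
Let J := colon (smeet T).
Let Q := Qsub T.

Variable m : M.
Hypothesis gen_m : forall y, exists r, y - r *: m \in Q.

Lemma colon_smeet_sub P : T P -> J `<=` colon P.
Proof. by move=> TP; apply: colonS; exact: smeet_sub. Qed.

Lemma Qsub_sub P : T P -> {subset Q <= P}.
Proof. by move=> TP; apply: ideal_smul_sub; exact: colon_smeet_sub. Qed.

(** Modulo Q every y is a multiple of the generator m, so r need only be tested on m. *)
Lemma colon_gen (N : submodClosed M) r :
  {subset Q <= N} -> r *: m \in N -> colon N r.
Proof.
move=> QN rmN y; have [t yQ] := gen_m y.
rewrite -[y](subrK (t *: m)) scalerDr; apply: rpredD.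
  by apply: rpredZ; exact: QN.
by rewrite scalerA mulrC -scalerA; exact: rpredZ.
Qed.

(** This makes P |-> (P : M) injective on T, and order reflecting. *)
Lemma subset_colon P P' : T P -> T P' -> colon P `<=` colon P' ->
  {subset P <= P'}.
Proof.
move=> TP TP' PP' y yP; have [t yQ] := gen_m y.
rewrite -[y](subrK (t *: m)); apply: rpredD; first exact: Qsub_sub.
apply/PP'/colon_gen; first exact: Qsub_sub.
by rewrite -[t *: m](subKr y); apply: submodB => //; exact: Qsub_sub yQ.
Qed.

Lemma colon_Qsub : colon Q `<=` J.
Proof.
by move=> r rQ; apply: colon_smeet => P TP; exact: colonS (Qsub_sub TP) _ rQ.
Qed.

(** The prime submodule sought is qm + Q. *)
Lemma spectrum_lift q : prime_ideal_set q -> J `<=` q ->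
  exists2 P, T P & colon P = q.
Proof.
move=> qprime Jq; have [qI q1 qM] := qprime.
pose p : {pred M} := fun e => `[< exists2 r, q r & e - r *: m \in Q >].
have p_closed : submod_closed p.
  split.
    by apply/asboolP; exists 0; [case: qI|rewrite scale0r subr0 rpred0].
  move=> a x y /asboolP[r qr xr] /asboolP[s qs ys]; apply/asboolP.
  exists (a * r + s); first by case: qI => _; apply.
  by rewrite scalerDl opprD addrACA -scalerA -scalerBr rpredD ?rpredZ.
pose pS := GRing.isSubmodClosed.Build R M p p_closed.
pose P : submodClosed M := HB.pack p pS.
have inP e : e \in P <-> exists2 r, q r & e - r *: m \in Q.
  by split=> [/asboolP|?]; last exact/asboolP.
have QP : {subset Q <= P}.
  by move=> e Qe; apply/inP; exists 0; [case: qI|rewrite scale0r subr0].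
(* If rm = sm modulo Q with s in q, then r - s is in [colon Q], hence in J and in q. *)
have qP r : r *: m \in P -> q r.
  move=> /inP[s qs]; rewrite -scalerBl => /colon_gen-/(_ (fun _ => id)).
  by move=> /colon_Qsub /Jq rs; rewrite -[r](subrK s); exact: idealD.
have Pq r : q r -> r *: m \in P.
  by move=> qr; apply/inP; exists r => //; rewrite subrr rpred0.
have colonP : colon P = q.
  by apply/seteqP; split=> r; [move=> /(_ m)/qP|move=> /Pq; exact: colon_gen].
exists P => //; split; last first.
  rewrite colonP; apply: subset_trans Jq => r N0r.
  by apply: colon_smeet => P' [_]; exact.
split=> [|r e reP].
  by exists m; apply/negP => mP; apply/q1/qP; rewrite scale1r.
(* Since e = tm modulo Q, re in P forces rt in q, and the primality of q applies. *)
rewrite colonP; have [t et] := gen_m e; have : q (r * t).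
  apply: qP; rewrite -scalerA -[t *: m](subKr e) scalerBr.
  by apply: submodB => //; apply: rpredZ; exact: QP.
move=> /qM[|qt]; [by left|right].
by rewrite -[e](subrK (t *: m)); apply: rpredD; [exact: QP|exact: Pq].
Qed.

(* If no such y existed, the multiplicative set of the products x^k y would
   avoid J, and a prime containing J and avoiding it would be strictly
   smaller than the colon of P. *)
Lemma minimals_annihilator P x : minimals T P -> colon P x ->
  exists2 y, ~ colon P y & J (x * y).
Proof.
move=> [TP Pmin] Px; have [Pid P1 PM] := colon_prime TP.1.
apply: contrapT => nJ.
pose S := [set z | exists k y, ~ colon P y /\ z = x ^+ k * y].
have [||_ _ [k [y [ny ->]]] [l [z [nz ->]]]|r Jr [k [y [ny rE]]]|q] :=
    @prime_ideal_avoiding _ J S.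
- exact: colon_ideal.
- by exists 0%N, 1; rewrite expr0 mul1r.
- by exists (k + l)%N, (y * z); rewrite exprD mulrACA; split=> // /PM[].
(* If x^k y is in J, every member of T has x or y in its colon, so xy is in J as well. *)
- apply: nJ; exists y => //; apply: colon_smeet => P' TP'.
  have [P'id P'1 P'M] := colon_prime TP'.1.
  have : colon P' (x ^+ k * y) by rewrite -rE; exact: colon_smeet_sub.
  move=> /P'M[|P'y]; last exact: idealMl P'id P'y.
  elim: k {rE} => [|k IH]; first by rewrite expr0 => /P'1.
  by rewrite exprS => /P'M[P'x|//]; exact: idealMr P'id P'x.
move=> [qprime Jq qS]; have [P' TP' colP'] := spectrum_lift qprime Jq.
have qP : q `<=` colon P.
  move=> r qr; apply: contrapT => nPr; apply: qS qr _.
  by exists 0%N, r; rewrite expr0 mul1r.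
have P'P : P' = P.
  by apply: Pmin => //; apply: subset_colon => //; rewrite colP'.
apply: (qS x); first by rewrite -colP' P'P.
by exists 1%N, 1; rewrite expr1 mulr1.
Qed.

(** By minimality P' does not contain P, so some x in (P : M) is outside (P' : M); its annihilator
    modulo J supplies the other element. *)
Lemma minimals_separated P P' : minimals T P -> minimals T P' -> P <> P' ->
  exists ab : R * R,
    [/\ ~ colon P ab.1, ~ colon P' ab.2 & J (ab.1 * ab.2)].
Proof.
move=> Pmin P'min PP'.
have : ~ (colon P `<=` colon P').
  by move=> /(subset_colon Pmin.1 P'min.1) /(P'min.2 _ Pmin.1).
move=> /existsNP[x /not_implyP[Px P'x]].
have [y ny Jxy] := minimals_annihilator Pmin Px.
by exists (y, x); split; rewrite // mulrC.
Qed.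

Lemma minimals_almost_orthogonal n (P : 'I_n -> submodClosed M) :
  injective P -> (forall i, minimals T (P i)) ->
  exists x : 'I_n -> R,
    (forall i, ~ colon (P i) (x i)) /\
    (forall i j, i != j -> J (x i * x j)).
Proof.
move=> Pinj Pmin.
have sep i j : exists ab : R * R, i != j ->
    [/\ ~ colon (P i) ab.1, ~ colon (P j) ab.2 & J (ab.1 * ab.2)].
  (* On the diagonal the pair is a mere default. *)
  have [_|ij] := eqVneq i j; first by exists (0, 0).
  have [|ab ?] := minimals_separated (Pmin i) (Pmin j); last by exists ab.
  by move=> /Pinj /eqP; apply/negP.
have [f fP] := choice (fun ij : 'I_n * 'I_n => sep ij.1 ij.2).
exists (fun i => \prod_(j | j != i) ((f (i, j)).1 * (f (j, i)).2)); split.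
  move=> i; have Pi := colon_prime (Pmin i).1.1.
  apply: prime_ideal_prod => // j ji /(prime_idealM Pi)[].
    by have [] := fP (i, j); rewrite 1?eq_sym.
  by have [] := fP (j, i).
move=> i j ij; have JI := colon_ideal (smeet T).
(* The j-th factor of x_i contains [(f (i, j)).1] and the i-th factor of x_j contains
   [(f (i, j)).2]; their product is in J. *)
rewrite (bigD1 j) 1?eq_sym// [X in _ * X](bigD1 i)//= mulrACA.
apply: (idealMr _ JI); rewrite [X in _ * X]mulrC mulrACA.
by apply: (idealMr _ JI); have [] := fP (i, j) ij.
Qed.

(** This is (xR + J)M. Including J confines its variety to T, because [colon N0] lies in J. *)
Definition basic_submod (x : R) : submodClosed M := ideal_smul M (x |` J).

Lemma Var_basic_submod x P : Var (basic_submod x) P <-> T P /\ colon P x.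
Proof.
split=> [[Pprime NP]|[TP Px]].
  have xP : colon P x by apply/NP/colon_ideal_smul; left.
  split=> //; split=> // r N0r; apply/NP/colon_ideal_smul; right.
  by apply: colon_smeet => P' [_]; exact.
split; first exact: TP.1.
apply: colonS; apply: ideal_smul_sub => r [->//|Jr]; exact: colon_smeet_sub.
Qed.

Lemma minimals_clique n (P : 'I_n -> submodClosed M) :
  injective P -> (forall i, minimals T (P i)) ->
  (n = 1%N -> vertices (zgraph T) !=set0) ->
  exists A, is_clique (zgraph T) A /\ #|` A| = n.
Proof.
(* A single minimal member gives no pair of orthogonal elements, so for n = 1 the clique is any
   given vertex. *)
move=> Pinj Pmin; have [->|n1 _] := eqVneq n 1%N.
  move=> [//|N NT]; exists [fset N]%fset; rewrite cardfs1; split=> //; split.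
    by move=> x /fset1P ->.
  by move=> x y /fset1P -> /fset1P ->; rewrite eqxx.
have [x [xP xJ]] := minimals_almost_orthogonal Pinj Pmin.
have xPj i j : i != j -> colon (P j) (x i).
  move=> ij; have Pj := colon_prime (Pmin j).1.1.
  by have [//|/xP] := prime_idealM Pj (colon_smeet_sub (Pmin j).1 (xJ _ _ ij)).
pose N i := basic_submod (x i).
have NNT i j : i != j -> Var (N i) `|` Var (N j) = T.
  move=> ij; apply/seteqP; split=> [p [] /Var_basic_submod[]//|p Tp].
  have [] := prime_idealM (colon_prime Tp.1) (colon_smeet_sub Tp (xJ _ _ ij)).
    by left; apply/Var_basic_submod.
  by right; apply/Var_basic_submod.
have NT i : Var (N i) <> T.
  by move=> NT; have := (Pmin i).1; rewrite -NT => /Var_basic_submod[_ /xP].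
(* If N i = N j, the union of their varieties would be [Var (N i)], which differs from T. *)
have Ninj : injective N.
  move=> i j Nij; apply/eqP; apply: contrapT => /negP ij; apply: (NT i).
  by rewrite -(NNT _ _ ij) -Nij setUid.
have other i : exists j, j != i := ord_other i n1.
(* N i is contained in P j for any j other than i. *)
have Nproper i : is_proper (N i).
  have [j ji] := other i; have [[[[e ePj] _] _] _] := Pmin j.
  exists e; apply: contraNN ePj; apply: ideal_smul_sub => r [->|].
    by apply: xPj; rewrite eq_sym.
  exact: colon_smeet_sub (Pmin j).1 r.
exists [fset N i | i : 'I_n]%fset; split; last first.
  by rewrite card_imfset//= size_enum_ord.
split=> [_ /imfsetP[i _ ->]|_ _ /imfsetP[i _ ->] /imfsetP[j _ ->] Nij].
  split=> //; have [j ji] := other i; exists (N j); split=> //.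
  by apply: NNT; rewrite eq_sym.
apply/asboolP; split; first exact/eqP.
by apply: NNT; apply: contraNneq Nij => ->.
Qed.

Lemma minimals_seq_clique (s : seq (submodClosed M)) :
  uniq s -> (forall P, P \in s -> minimals T P) ->
  (size s = 1%N -> vertices (zgraph T) !=set0) ->
  exists A, is_clique (zgraph T) A /\ #|` A| = size s.
Proof.
move=> s_uniq sT; apply: (@minimals_clique _ (tnth (in_tuple s))).
  exact/tuple_uniqP.
by move=> i; apply: sT; exact: mem_tnth.
Qed.

Lemma counting_le_clique_number : vertices (zgraph T) !=set0 ->
  (counting (minimals T) <= clique_number (zgraph T))%E.
Proof.
move=> vT; have [finT|infT] := pselect (finite_set (minimals T)).
  rewrite /counting asboolT//.
  have [||_|A [Acl <-]] := @minimals_seq_clique (fset_set (minimals T)) => //.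
  - exact: fset_uniq.
  - by move=> P; rewrite in_fset_set// inE.
  - exact: clique_number_ge.
rewrite /counting asboolF// leye_eq; apply/eqP/eq_infty => r.
(* The size of B is chosen to exceed the real bound r. *)
have [B BT rB] := infinite_set_fset (Num.truncn r).+1 infT.
have [||_|A [Acl AB]] := @minimals_seq_clique B => //; first exact: fset_uniq.
apply: le_trans (clique_number_ge Acl); rewrite lee_fin AB.
by apply: le_trans (ltW (truncnS_gt r)) _; rewrite ler_nat.
Qed.

Lemma girth_of_three_minimals :
  (3%:R%:E <= counting (minimals T) :> \bar Rdefinitions.R)%E ->
  girth (zgraph T) = 3%:R%:E.
Proof.
move=> T3.
have [B BT B3] : exists2 B : {fset submodClosed M},
    [set` B] `<=` minimals T & (3 <= #|` B|)%N.
  have [finT|infT] := pselect (finite_set (minimals T)).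
    exists (fset_set (minimals T)); first by rewrite fset_setK.
    by move: T3; rewrite /counting asboolT// lee_fin ler_nat.
  exact: infinite_set_fset.
(* Cutting down to exactly three also makes the side condition for size 1 vacuous. *)
have size3 : size (take 3 B) = 3%N by rewrite size_takel.
have [|||A [Acl A3]] := @minimals_seq_clique (take 3 B).
- by rewrite take_uniq// fset_uniq.
- by move=> P /mem_take; exact: BT.
- by rewrite size3.
- by apply: (girth_triangle Acl); rewrite A3.
Qed.

End CyclicSpectrum.

Theorem proposition4p10 (R : comNzRingType) (M : lmodType R)
    (T : set (submodClosed M))
    (T_nonempty : T !=set0)
    (T_closed : zariski_closed T)
    (Mbar_cyclic : cyclic_module (Mbar T)) :
  [/\ forall (n : nat) (P : 'I_n -> submodClosed M),
        injective P -> (forall i, minimals T (P i)) ->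
        (n = 1%N -> vertices (zgraph T) !=set0) ->
        exists A, is_clique (zgraph T) A /\ #|` A| = n,
      (vertices (zgraph T) !=set0 ->
        (counting (minimals T) <= clique_number (zgraph T))%E) /\
      ((3%:R%:E <= counting (minimals T) :> \bar real)%E ->
        girth (zgraph T) = 3%:R%:E) &
      T = Spec M ->
      vertices (zgraph (Spec M)) !=set0 ->
      prime_radical (szero (Mbar T)) = szero (Mbar T) ->
      chromatic_number (zgraph (Spec M)) = clique_number (zgraph (Spec M)) /\
      clique_number (zgraph (Spec M)) = counting (minimals T)].
Proof.
have [N0 TN0] := T_closed; subst T.
have [m gen_m] := cyclic_quotmod Mbar_cyclic.
split; first exact: minimals_clique gen_m.
  split; first exact: counting_le_clique_number gen_m.
  exact: girth_of_three_minimals gen_m.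
(* With Spec M rewritten as T, the three bounds close a cycle: |Min(T)| is at most the clique
   number, which is at most the chromatic number, which is at most |Min(T)|. *)
move=> <- vT _; have le1 := counting_le_clique_number gen_m vT.
have le2 := clique_le_chromatic (zgraph (Var N0)).
have le3 := chromatic_le_counting N0.
split; apply/eqP; rewrite eq_le.
  by rewrite le2 (le_trans le3 le1).
by rewrite le1 (le_trans le2 le3).
Qed.
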